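(* Let $A$ and $B$ be two loxodromic elements in $\mathrm{SU}(3,1)$ such that they generate a non-singular subgroup $\langle A,B\rangle$. Then $\langle A,B\rangle$ is determined up to conjugacy in $\mathrm{SU}(3,1)$ by the parameters $\mathrm{tr}(A)$, $\mathrm{tr}(B)$, $\sigma(A)$, $\sigma(B)$, $\mathbb X_k(A,B)$ $(k=1,2,3)$, any one of the non-zero $\alpha$-invariants and any one of the non-zero $\beta$-invariants. That is: if $(A,B)$ and $(A',B')$ are pairs of loxodromic elements generating non-singular subgroups, if $i,j\in\{1,2\}$ are such that $\alpha_i(A,B)$ and $\beta_j(A,B)$ are well defined and non-zero, and if $\mathrm{tr}(A)=\mathrm{tr}(A')$, $\mathrm{tr}(B)=\mathrm{tr}(B')$, $\sigma(A)=\sigma(A')$, $\sigma(B)=\sigma(B')$, $\mathbb X_k(A,B)=\mathbb X_k(A',B')$ for $k=1,2,3$, $\alpha_i(A,B)=\alpha_i(A',B')$ and $\beta_j(A,B)=\beta_j(A',B')$, then there is $C\in \mathrm{SU}(3,1)$ with $CAC^{-1}=A'$ and $CBC^{-1}=B'$.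
   Context: $\mathbb C^{3,1}$ is $\mathbb C^4$ with the Hermitian form $\langle z,w\rangle=z_1\bar w_4+z_2\bar w_2+z_3\bar w_3+z_4\bar w_1$ of signature $(3,1)$; $\mathrm{SU}(3,1)$ is the group of determinant-one matrices preserving it. A vector $v\ne0$ is positive, null or negative according to the sign of $\langle v,v\rangle$. Complex hyperbolic space $\mathbf H^3_{\mathbb C}$ is the projectivization of the negative vectors, and $\partial\mathbf H^3_{\mathbb C}$ is the projectivization of the null vectors. A $\mathbb C^2$-plane is the projectivization (in $\mathbf H^3_{\mathbb C}$) of a copy of $\mathbb C^{2,1}$ in $\mathbb C^{3,1}$; a $\mathbb C^2$-chain is the boundary in $\partial\mathbf H^3_{\mathbb C}$ of a $\mathbb C^2$-plane. The $\mathbb C^2$-chain polar to a positive vector $c$ is the set of points of $\partial\mathbf H^3_{\mathbb C}$ represented by null vectors in $c^\perp$. An element $A\in\mathrm{SU}(3,1)$ is loxodromic if it fixes no point of $\mathbf H^3_{\mathbb C}$ and exactly two points of $\partial\mathbf H^3_{\mathbb C}$. Its eigenvalues are $re^{i\theta},r^{-1}e^{i\theta},e^{i\phi},e^{-i(2\theta+\phi)}$ with $r>1$, $\theta,\phi\in(-\pi,\pi]$. $\mathbf a_A,\mathbf r_A$ denote null eigenvectors for $re^{i\theta}$, $r^{-1}e^{i\theta}$ (lifts of the attracting and repelling fixed points), and $\mathbf x_A,\mathbf y_A$ denote positive, mutually orthogonal eigenvectors for $e^{i\phi}$, $e^{-i(2\theta+\phi)}$ respectively, with $\langle\mathbf x_A,\mathbf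 x_A\rangle=\langle\mathbf y_A,\mathbf y_A\rangle=1$. The labelling (which of the two unit-modulus eigenvalues is called $e^{i\phi}$) is a fixed convention depending only on the set of eigenvalues; if the two coincide, $\mathbf x_A,\mathbf y_A$ is a chosen orthonormal basis of the positive eigenspace. $\mathrm{tr}$ is the trace and $\sigma(A)=\frac12(\mathrm{tr}^2(A)-\mathrm{tr}(A^2))$. For vectors put $$\mathbb X(z_1,z_2,z_3,z_4)=[z_1,z_2,z_3,z_4]=\frac{\langle z_3,z_1\rangle\langle z_4,z_2\rangle}{\langle z_4,z_1\rangle\langle z_3,z_2\rangle}$$ whenever defined. Then $\mathbb X_1(A,B)=[\mathbf a_B,\mathbf a_A,\mathbf r_A,\mathbf r_B]$, $\mathbb X_2(A,B)=[\mathbf a_B,\mathbf r_A,\mathbf a_A,\mathbf r_B]$, $\mathbb X_3(A,B)=[\mathbf a_A,\mathbf r_A,\mathbf a_B,\mathbf r_B]$. The $\alpha$-invariants are $\alpha_1(A,B)=\mathbb X(\mathbf r_A,\mathbf a_A,\mathbf x_B,\mathbf a_B)$, $\alpha_2(A,B)=\mathbb X(\mathbf r_A,\mathbf a_A,\mathbf y_B,\mathbf a_B)$; the $\beta$-invariants are $\beta_1(A,B)=\mathbb X(\mathbf r_B,\mathbf a_B,\mathbf x_A,\mathbf a_A)$, $\beta_2(A,B)=\mathbb X(\mathbf r_B,\mathbf a_B,\mathbf y_A,\mathbf a_A)$. A pair $(A,B)$ of loxodromic elements is non-singular if: (i) $A$ and $B$ have no common fixed point; (ii) the fixed points of $A$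 and $B$ (in $\partial\mathbf H^3_{\mathbb C}$) do not lie on a common $\mathbb C^2$-chain; (iii) the fixed-point set of $A$ is disjoint from at least one of the $\mathbb C^2$-chains polar to the positive eigenvectors $\mathbf x_B,\mathbf y_B$ of $B$, and the fixed-point set of $B$ is disjoint from at least one of the $\mathbb C^2$-chains polar to $\mathbf x_A,\mathbf y_A$. A free subgroup $\langle A,B\rangle$ is non-singular if the generating pair $(A,B)$ is non-singular. *)

(* Defs.v *)
From mathcomp Require Import all_boot all_order all_algebra.
From mathcomp Require Import all_classical all_reals trigo.
From mathcomp Require Export complex.

Set Implicit Arguments.
Unset Strict Implicit.
Unset Printing Implicit Defensive.

Import Order.TTheory GRing.Theory Num.Theory.
Local Open Scope classical_set_scope.
Local Open Scope ring_scope.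

Section ComplexHyperbolic.
Variable R : realType.
Local Notation C := R[i].
Local Notation V := 'cV[C]_4.
Local Notation M := 'M[C]_4.

(* Matrices act on column vectors on the left; coordinates are numbered from 0.
   In R[i], [0 < x] says that x is real and positive. *)
Definition herm (z w : V) : C :=
  z 0 0 * (w 3 0)^* + z 1 0 * (w 1 0)^* + z 2 0 * (w 2 0)^* + z 3 0 * (w 0 0)^*.

(* C^{2,1}: the analogous form of signature (2,1) on C^3. *)
Definition herm21 (z w : 'cV[C]_3) : C :=
  z 0 0 * (w 2 0)^* + z 1 0 * (w 1 0)^* + z 2 0 * (w 0 0)^*.

Definition SU31 (A : M) : Prop :=
  \det A = 1 /\ forall z w : V, herm (A *m z) (A *m w) = herm z w.

(* Points of the projective space are given by nonzero lifts, and a set of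
   points by the set of all their lifts. *)
Definition null (v : V) : Prop := v != 0 /\ herm v v = 0.
Definition negative (v : V) : Prop := v != 0 /\ herm v v < 0.

Definition same_point (v w : V) : Prop := exists2 a : C, a != 0 & v = a *: w.

Definition fixes (A : M) (v : V) : Prop := exists a : C, A *m v = a *: v.

Definition bd_fixed (A : M) : set V := [set v | null v /\ fixes A v].

Definition loxodromic (A : M) : Prop :=
  [/\ SU31 A,
      forall v, negative v -> ~ fixes A v &
      exists u v : V, [/\ bd_fixed A u, bd_fixed A v, ~ same_point u v &
        forall w, bd_fixed A w -> same_point w u \/ same_point w v]].

(* A copy of C^{2,1} in C^{3,1} is the image of a form-preserving linear map
   C^{2,1} -> C^{3,1}; such a map is injective as herm21 is nondegenerate. *)
Definition C21_embedding (E : 'M[C]_(4, 3)) : Prop :=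
  forall z w : 'cV[C]_3, herm (E *m z) (E *m w) = herm21 z w.

Definition C2_chain (S : set V) : Prop :=
  exists2 E : 'M[C]_(4, 3), C21_embedding E &
    S = [set v | null v /\ exists z : 'cV[C]_3, v = E *m z].

(* The C^2-chain polar to a positive vector c. *)
Definition polar_chain (c : V) : set V := [set v | null v /\ herm v c = 0].

Definition expi (t : R) : C := (cos t +i* sin t)%C.

Definition eigenframe (A : M) (r theta phi : R) (a rep x y : V) : Prop :=
  [/\ 1 < r, - pi < theta <= pi & - pi < phi <= pi] /\
  [/\ null a /\ A *m a = ((r%:C)%C * expi theta) *: a,
      null rep /\ A *m rep = ((r^-1%:C)%C * expi theta) *: rep,
      herm x x = 1 /\ A *m x = expi phi *: x,
      herm y y = 1 /\ A *m y = expi (- (2 * theta + phi)) *: y &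
      herm x y = 0].

(* The standing choices: for each loxodromic element its eigenvalue parameters
   and eigenvectors, the labelling of the unit-modulus eigenvalues depending
   only on the set of eigenvalues. *)
Record marking := Marking {
  mod_of : M -> R;
  theta_of : M -> R;
  phi_of : M -> R;
  att : M -> V;
  rpl : M -> V;
  xvec : M -> V;
  yvec : M -> V;
  eigenframeP : forall A, loxodromic A ->
    eigenframe A (mod_of A) (theta_of A) (phi_of A)
      (att A) (rpl A) (xvec A) (yvec A);
  phi_ofP : forall A B, loxodromic A -> loxodromic B ->
    eigenvalue A =1 eigenvalue B -> phi_of A = phi_of B
}.

Definition sigma (A : M) : C := 2^-1 * ((\tr A) ^+ 2 - \tr (A *m A)).

Definition cross (z1 z2 z3 z4 : V) : C :=
  (herm z3 z1 * herm z4 z2) / (herm z4 z1 * herm z3 z2).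

Definition cross_defined (z1 z2 z3 z4 : V) : Prop :=
  herm z4 z1 * herm z3 z2 != 0.

Section Invariants.
Variable m : marking.
Implicit Types A B : M.

Definition X1 A B : C := cross (att m B) (att m A) (rpl m A) (rpl m B).
Definition X2 A B : C := cross (att m B) (rpl m A) (att m A) (rpl m B).
Definition X3 A B : C := cross (att m A) (rpl m A) (att m B) (rpl m B).

(* The indices 1, 2 of the alpha- and beta-invariants are 0, 1 : 'I_2. *)
Definition pvec (i : 'I_2) A : V := if i == 0 then xvec m A else yvec m A.

Definition alpha (i : 'I_2) A B : C :=
  cross (rpl m A) (att m A) (pvec i B) (att m B).
Definition alpha_defined (i : 'I_2) A B : Prop :=
  cross_defined (rpl m A) (att m A) (pvec i B) (att m B).

Definition beta (j : 'I_2) A B : C :=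
  cross (rpl m B) (att m B) (pvec j A) (att m A).
Definition beta_defined (j : 'I_2) A B : Prop :=
  cross_defined (rpl m B) (att m B) (pvec j A) (att m A).

Definition nonsingular_pair A B : Prop :=
  [/\ bd_fixed A `&` bd_fixed B = set0,
      ~ (exists2 S, C2_chain S & bd_fixed A `|` bd_fixed B `<=` S),
      exists i : 'I_2, bd_fixed A `&` polar_chain (pvec i B) = set0 &
      exists j : 'I_2, bd_fixed B `&` polar_chain (pvec j A) = set0].

End Invariants.

(* Words in a set of matrices: the letter (g, false) stands for g, and
   (g, true) for its inverse. *)
Definition letter_val (l : M * bool) : M := if l.2 then invmx l.1 else l.1.
Definition word_val (w : seq (M * bool)) : M :=
  foldr (fun l N => letter_val l *m N) 1%:M w.
Definition word_over (S : set M) (w : seq (M * bool)) : Prop :=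
  forall l, l \in w -> S l.1.
Definition reduced (w : seq (M * bool)) : bool :=
  sorted (fun k l => ~~ ((k.1 == l.1) && (k.2 != l.2))) w.

Definition generated (S : set M) : set M :=
  [set N | exists2 w, word_over S w & word_val w = N].

Definition free_group (G : set M) : Prop :=
  exists S : set M, generated S = G /\
    forall w, word_over S w -> reduced w -> word_val w = 1%:M -> w = [::].

Definition nonsingular_subgroup (m : marking) (A B : M) : Prop :=
  free_group (generated [set A; B]) /\ nonsingular_pair m A B.

End ComplexHyperbolic.

(* Main.v *)
(* A pair is governed by the four null vectors a_A, r_A, a_B, r_B.  Since they
   lie on no common C^2-chain, they form a basis of C^4, so an isometry is
   determined by its values on them.  The cross-ratios fix their Gram matrix up
   to rescaling: X1 X3 / X2 determines the square of the phase of the triple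
   product <a_A,a_B><a_B,r_A><r_A,a_A>, and the remaining sign is settled
   because the real part of this product is negative for independent null
   vectors in signature (3,1).  Hence some C in SU(3,1) matches the fixed points
   of (A,B) with those of (A',B').  Trace and sigma determine the characteristic
   polynomial, because e3 is the conjugate of e1, and with the labelling
   convention the eigenvalues.  Finally beta_j is the ratio
   <p,r_B>/<p,a_B>, up to factors that C preserves, so it determines the line of
   the polar vector p of A inside the plane orthogonal to a_A, r_A; the last
   eigenvector is then its orthogonal complement.  Thus C A C^-1 = A', and
   symmetrically for B, since alpha(A,B) = beta(B,A). *)

Require Import Defs.
From mathcomp Require Import all_boot all_order all_algebra.
From mathcomp Require Import all_classical all_reals trigo.
From mathcomp Require Import ring.
Import Order.TTheory GRing.Theory Num.Theory.
Local Open Scope ring_scope.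
Set Implicit Arguments.
Unset Strict Implicit.
Unset Printing Implicit Defensive.

Section HermitianForm.
Variable R : realType.
Local Notation C := R[i].
Local Notation V := 'cV[C]_4.
Local Notation M := 'M[C]_4.
Implicit Types (u v w z : V) (A B N : M) (k : C).

(** * Sesquilinearity of the form and its null vectors *)

Lemma hermDl u v w : herm (u + v) w = herm u w + herm v w.
Proof. by rewrite /herm !mxE; ring. Qed.

Lemma hermZl k u w : herm (k *: u) w = k * herm u w.
Proof. by rewrite /herm !mxE; ring. Qed.

Lemma herm_conj u w : (herm u w)^* = herm w u.
Proof. by rewrite /herm !rmorphD !rmorphM /= !conjCK; ring. Qed.

Lemma hermDr u v w : herm u (v + w) = herm u v + herm u w.
Proof. by rewrite -[LHS]herm_conj hermDl rmorphD /= !herm_conj. Qed.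

Lemma hermZr k u w : herm u (k *: w) = k^* * herm u w.
Proof. by rewrite -[LHS]herm_conj hermZl rmorphM /= !herm_conj. Qed.

Lemma herm0l w : herm 0 w = 0.
Proof. by rewrite -(scale0r 0) hermZl mul0r. Qed.

Definition hermE := (hermDl, hermDr, hermZl, hermZr).

Lemma herm_eq0_sym u v : (herm u v == 0) = (herm v u == 0).
Proof. by rewrite -herm_conj conjC_eq0. Qed.

Lemma cV4P u v :
  u 0 0 = v 0 0 -> u 1 0 = v 1 0 -> u 2 0 = v 2 0 -> u 3 0 = v 3 0 -> u = v.
Proof.
move=> e0 e1 e2 e3; apply/colP => -[[|[|[|[|//]]]] i4].
- by have -> : Ordinal i4 = 0 by apply: val_inj.
- by have -> : Ordinal i4 = 1 by apply: val_inj.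
- by have -> : Ordinal i4 = 2 by apply: val_inj.
- by have -> : Ordinal i4 = 3 by apply: val_inj.
Qed.

Lemma sum_mulconj_eq0 (x y : C) : x * x^* + y * y^* = 0 -> x = 0 /\ y = 0.
Proof.
move/eqP; rewrite paddr_eq0 ?mul_conjC_ge0 // !mul_conjC_eq0.
by case/andP=> /eqP-> /eqP->.
Qed.

(** Signature (3,1) admits no totally isotropic plane. In coordinates, a null vector with vanishing
    last coordinate is a multiple of the first basis vector, since the form is then definite on the
    two middle coordinates. *)
Lemma orthogonal_null_colinear u v :
  null u -> null v -> herm u v = 0 -> exists k, v = k *: u.
Proof.
move=> [u0 nu] [_ nv] uv.
have vu : herm v u = 0 by rewrite -herm_conj uv conjC0.
have [u3|u3] := eqVneq (u 3 0) 0.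
  move: nu vu; rewrite /herm u3 conjC0 mulr0 mul0r add0r addr0.
  case/sum_mulconj_eq0 => u1 u2; rewrite u1 u2 conjC0 !mulr0 !add0r.
  have u00 : u 0 0 != 0.
    by apply: contraNneq u0 => u00; apply/eqP/cV4P; rewrite !mxE.
  move/eqP; rewrite mulf_eq0 conjC_eq0 (negPf u00) orbF => /eqP v3.
  move: nv; rewrite /herm v3 conjC0 mulr0 mul0r add0r addr0.
  case/sum_mulconj_eq0 => v1 v2.
  exists (v 0 0 / u 0 0).
  by apply: cV4P; rewrite !mxE ?u1 ?u2 ?u3 ?mulr0 // mulfVK.
(* Killing the last coordinate makes [w] a multiple of the first basis vector; orthogonality to [u],
   where [u 3 0] is non-zero, then forces [w] to vanish. *)
pose w := v + (- (v 3 0 / u 3 0)) *: u.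
have wu : herm w u = 0 by rewrite !hermE vu nu mulr0 addr0.
have ww : herm w w = 0 by rewrite !hermE vu nu uv nv !mulr0 !addr0.
have w3 : w 3 0 = 0 by rewrite !mxE mulNr mulfVK // subrr.
move: ww wu; rewrite /herm w3 conjC0 mulr0 mul0r add0r addr0.
case/sum_mulconj_eq0 => w1 w2; rewrite w1 w2 !mul0r !addr0.
move/eqP; rewrite mulf_eq0 conjC_eq0 (negPf u3) orbF => /eqP w0.
exists (v 3 0 / u 3 0); apply/eqP; rewrite -subr_eq0 -scaleNr; apply/eqP.
by rewrite -/w; apply: cV4P; rewrite [RHS]mxE.
Qed.

(** * Bases of C^4 as matrices of columns, and nondegeneracy of the form *)

Definition cols4 (p : 'I_4 -> V) : M := \matrix_(i, j) p j i 0.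

Definition vec4 u v w z : 'I_4 -> V := tnth [tuple u; v; w; z].

Lemma cols4_mulE u v w z (c : V) :
  cols4 (vec4 u v w z) *m c = c 0 0 *: u + c 1 0 *: v + c 2 0 *: w + c 3 0 *: z.
Proof.
apply/colP=> i; rewrite !mxE !big_ord_recl big_ord0 !mxE addr0 !addrA.
rewrite /vec4 !(tnth_nth 0) /=.
have -> : lift ord0 (lift ord0 (lift ord0 ord0)) = 3 :> 'I_4 by apply: val_inj.
have -> : lift ord0 (lift ord0 ord0) = 2 :> 'I_4 by apply: val_inj.
have -> : lift ord0 ord0 = 1 :> 'I_4 by apply: val_inj.
by rewrite ![_ * c _ _]mulrC.
Qed.

Definition basis4 u v w z : Prop := cols4 (vec4 u v w z) \in unitmx.

Lemma basis4P u v w z :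
  (forall c0 c1 c2 c3 : C, c0 *: u + c1 *: v + c2 *: w + c3 *: z = 0 ->
     [/\ c0 = 0, c1 = 0, c2 = 0 & c3 = 0]) -> basis4 u v w z.
Proof.
move=> free; rewrite /basis4 -unitmx_tr -row_free_unit -kermx_eq0.
apply/eqP/row_matrixP => i; rewrite row0; apply: trmx_inj; rewrite trmx0.
set k := row i _; have : k *m (cols4 (vec4 u v w z))^T = 0.
  by apply/eqP; rewrite -sub_kermx row_sub.
move/(congr1 trmx); rewrite trmx_mul trmxK trmx0 cols4_mulE.
by case/free => *; apply: cV4P; rewrite [RHS]mxE.
Qed.

Lemma basis4_swap u v w z : basis4 u v w z -> basis4 w z u v.
Proof.
move=> b; apply: basis4P => c0 c1 c2 c3 c.
pose d : V := \col_i tnth [tuple c2; c3; c0; c1] i.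
have d0 : d = 0.
  apply: (can_inj (mulKmx b)); rewrite mulmx0 cols4_mulE !mxE !(tnth_nth 0) /=.
  by rewrite -[LHS]addrA -[RHS]c -[RHS]addrA [RHS]addrC.
have h i := congr1 (fun x : V => x i 0) d0.
by move: (h 0) (h 1) (h 2) (h 3); rewrite !mxE !(tnth_nth 0) /= => -> -> -> ->.
Qed.

Lemma basis4_span u v w z : basis4 u v w z -> forall t : V,
  exists c : V, t = c 0 0 *: u + c 1 0 *: v + c 2 0 *: w + c 3 0 *: z.
Proof.
move=> b t; exists (invmx (cols4 (vec4 u v w z)) *m t).
by rewrite -cols4_mulE mulKVmx.
Qed.

Lemma herm_nondeg t : (forall w, herm t w = 0) -> t = 0.
Proof.
move=> h; have e (i j : 'I_4) : (delta_mx i (0 : 'I_1) : V) j 0 = (j == i)%:R :> C.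
  by rewrite mxE eqxx andbT.
apply: cV4P; rewrite [RHS]mxE.
(* The form pairs coordinate 0 with coordinate 3 and each middle coordinate with itself, which
   dictates the test vectors. *)
- by have := h (delta_mx 3 0); rewrite /herm !e /= conjC1 conjC0 !mulr0 mulr1 !addr0.
- by have := h (delta_mx 1 0); rewrite /herm !e /= conjC1 conjC0 !mulr0 mulr1 !addr0 add0r.
- by have := h (delta_mx 2 0); rewrite /herm !e /= conjC1 conjC0 !mulr0 mulr1 !addr0 !add0r.
- by have := h (delta_mx 0 0); rewrite /herm !e /= conjC1 conjC0 !mulr0 mulr1 !add0r.
Qed.

Lemma basis4_orthogonal_eq0 u v w z t : basis4 u v w z ->
  herm t u = 0 -> herm t v = 0 -> herm t w = 0 -> herm t z = 0 -> t = 0.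
Proof.
move=> b tu tv tw tz; apply: herm_nondeg => s.
have [c ->] := basis4_span b s.
by rewrite !hermE tu tv tw tz !mulr0 !addr0.
Qed.

Lemma basis4_eq A B u v w z : basis4 u v w z ->
  A *m u = B *m u -> A *m v = B *m v -> A *m w = B *m w -> A *m z = B *m z ->
  A = B.
Proof.
move=> b Au Av Aw Az.
have e (c : V) : A *m c = B *m c.
  have [d ->] := basis4_span b c.
  by rewrite !mulmxDr -!scalemxAr Au Av Aw Az.
apply/matrixP => i j.
by have := congr1 (fun x : V => x i 0) (e (delta_mx j 0)); rewrite -!colE !mxE.
Qed.

(** * Isometries, Gram matrices and normalisation of the determinant *)

Definition preserves_herm A := forall z w, herm (A *m z) (A *m w) = herm z w.

Lemma det_preserves_herm A : preserves_herm A -> `|\det A| = 1.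
Proof.
move=> hA.
(* [J] is the Gram matrix of the form, which swaps the indices 0 and 3. Invariance becomes A^T J
   conj(A) = J, and taking determinants gives |det A|^2 = 1. *)
pose J : M := \matrix_(i, j) (nth 0 [:: 3; 1; 2; 0] i == j)%N%:R.
have hE z w : herm z w = (z^T *m J *m map_mx Num.conj w) 0 0.
  rewrite mxE !big_ord_recl big_ord0 !mxE !big_ord_recl !big_ord0 !mxE /=.
  have -> : lift ord0 (lift ord0 (lift ord0 ord0)) = 3 :> 'I_4 by apply: val_inj.
  have -> : lift ord0 (lift ord0 ord0) = 2 :> 'I_4 by apply: val_inj.
  have -> : lift ord0 ord0 = 1 :> 'I_4 by apply: val_inj.
  have -> : ord0 = 0 :> 'I_4 by apply: val_inj.
  by rewrite /herm; ring.
have e (N : M) i j : N i j = ((delta_mx i 0 : V)^T *m N *m (delta_mx j 0 : V)) 0 0.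
  by rewrite trmx_delta -rowE -colE !mxE.
have JJ : J *m J = 1%:M.
  apply/matrixP=> i j; rewrite !mxE !big_ord_recl big_ord0 !mxE.
  by case: i j => [[|[|[|[|//]]]] ?] [[|[|[|[|//]]]] ?]; rewrite /= ?mulr1 ?mul0r ?mulr0 ?addr0 ?add0r.
have J0 : \det J != 0.
  apply/eqP => J0; have := congr1 determinant JJ.
  by rewrite det_mulmx J0 mul0r det1 => /esym/eqP; rewrite oner_eq0.
have AJA : A^T *m J *m map_mx Num.conj A = J.
  apply/matrixP => i j; rewrite [LHS]e [RHS]e.
  have {1}-> : (delta_mx j 0 : V) = map_mx Num.conj (delta_mx j 0 : V).
    by rewrite map_delta_mx.
  rewrite -!mulmxA -map_mxM !mulmxA -trmx_mul -hE hA hE.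
  by rewrite map_delta_mx.
have := congr1 determinant AJA.
rewrite !det_mulmx det_tr det_map_mx mulrAC -normCK => /(canRL (mulfK J0)).
rewrite divff // => /eqP.
by rewrite sqrp_eq1 // => /eqP.
Qed.

(* The factor [s] is forced to be the squared modulus of the scaling of the
   first vector, so its positivity, which comes from the sign of the real part
   of the triple products, is what makes the rescaling possible. *)
Lemma gram_rescaling
    (g12 g13 g14 g23 g24 g34 h12 h13 h14 h23 h24 h34 : C) :
  [/\ g12 != 0, g13 != 0, g14 != 0 & [/\ g23 != 0, g24 != 0 & g34 != 0]] ->
  [/\ h12 != 0, h13 != 0, h14 != 0 & [/\ h23 != 0, h24 != 0 & h34 != 0]] ->
  g23 * g14^* / (g34^* * g12^*) = h23 * h14^* / (h34^* * h12^*) ->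
  g13 * g24^* / (g34^* * g12) = h13 * h24^* / (h34^* * h12) ->
  g13^* * g24^* / (g14^* * g23^*) = h13^* * h24^* / (h14^* * h23^*) ->
  let T := g13 * g23^* * g12^* in let T' := h13 * h23^* * h12^* in
  T + T^* < 0 -> T' + T'^* < 0 ->
  exists k1 k2 k3 k4 : C,
    [/\ k1 != 0, k2 != 0, k3 != 0 & k4 != 0] /\
    [/\ k1 * k2^* * g12 = h12, k1 * k3^* * g13 = h13, k1 * k4^* * g14 = h14 &
     [/\ k2 * k3^* * g23 = h23, k2 * k4^* * g24 = h24 & k3 * k4^* * g34 = h34]].
Proof.
move=> [g12n g13n g14n [g23n g24n g34n]] [h12n h13n h14n [h23n h24n h34n]].
move=> X1E X2E X3E T T' Tn T'n.
have cn (x : C) : x != 0 -> x^* != 0 by rewrite conjC_eq0.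
have nz := (conjC_eq0, g12n, g13n, g14n, g23n, g24n, g34n,
  h12n, h13n, h14n, h23n, h24n, h34n).
have T0 : T != 0 by rewrite !mulf_neq0 ?cn.
have T'0 : T' != 0 by rewrite !mulf_neq0 ?cn.
(* The combination X1 X3 / X2 collapses to this quotient of Gram entries; hence [T' / T] is real. *)
have TE : T^* / T = T'^* / T'.
  transitivity ((g23 * g14^* / (g34^* * g12^*)) * (g13^* * g24^* / (g14^* * g23^*))
     / (g13 * g24^* / (g34^* * g12))).
    by rewrite /T !rmorphM /= !conjCK; field; rewrite ?nz.
  rewrite X1E X2E X3E /T' !rmorphM /= !conjCK; field.
  by rewrite ?nz.
(* For a rescaling as wanted, [T' / T] is the squared modulus of [k1 * k2 * k3], and passing from
   [g23] to [h23] costs that of [k2 * k3]; what is left is that of [k1]. *)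
pose s := T' / T * ((g23 * g23^*) / (h23 * h23^*)).
have s_gt0 : 0 < s.
  apply: mulr_gt0; last by rewrite divr_gt0 ?mul_conjC_gt0.
  (* Being real, [T' / T] multiplies [T + T^*] into [T' + T'^*], and both are negative. *)
  rewrite -(nmulr_llt0 _ Tn) mulrDr divfK //.
  by rewrite mulrAC -mulrA TE mulrCA mulfV // mulr1.
pose t := sqrtC s.
have t_gt0 : 0 < t by rewrite sqrtC_gt0.
have tn : t != 0 by rewrite gt_eqF.
have {}nz := (nz, tn).
have tc : t^* = t by apply/CrealP; rewrite gtr0_real.
have tt : t ^+ 2 = s by rewrite sqrtCK.
have sE : s = (h13 * h12^* * g23) / (g13 * g12^* * h23).
  by rewrite /s /T /T'; field; rewrite ?nz.
have sE' : s = (h13^* * h12 * g23^*) / (g13^* * g12 * h23^*).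
  rewrite -tt -tc -rmorphXn /= tt sE !(rmorphM, fmorphV) /= !conjCK; field.
  by rewrite ?nz.
(* A common phase is free, so [k1] is taken positive; the entries 12, 23 and 34 then determine [k2],
   [k3], [k4] in turn. Entry 13 follows from [t ^+ 2 = s], entry 14 from [X1E], and entry 24 from
   [X2E] together with [s]. *)
exists t, (h12^* / (t * g12^*)), (h23^* * t * g12 / (g23^* * h12)).
exists (h34^* * g23 * h12^* / (g34^* * h23 * t * g12^*)).
rewrite !(rmorphM, fmorphV) /= !conjCK tc.
split; first by split; rewrite ?mulf_neq0 ?invr_eq0 ?mulf_neq0 ?cn.
have X1C := congr1 Num.conj X1E; have X2C := congr1 Num.conj X2E.
rewrite !(rmorphM, fmorphV) /= !conjCK in X1C X2C.
have h14E : h14 = g23^* * g14 / (g34 * g12) * (h34 * h12) / h23^*.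
  by rewrite X1C; field; rewrite ?nz.
have h24E : h24 = g13^* * g24 / (g34 * g12^*) * (h34 * h12^*) / h13^*.
  by rewrite X2C; field; rewrite ?nz.
split; [|transitivity (t ^+ 2 * (h23 * g12^* / (g23 * h12^*)) * g13)| |split].
- by field; rewrite ?nz.
- by field; rewrite ?nz.
- by rewrite tt sE; field; rewrite ?nz.
- by rewrite h14E; field; rewrite ?nz.
- by field; rewrite ?nz.
- rewrite h24E.
  transitivity (h12^* / g12^* * (h34 * g23^* * h12 / (g34 * h23^* * g12)) / t ^+ 2 * g24).
    by field; rewrite ?nz.
  by rewrite tt sE'; field; rewrite ?nz.
- by field; rewrite ?nz.
Qed.

(** The determinant has modulus one, so a fourth root of its inverse is a unimodular scalar, which
    corrects the determinant and keeps the form. *)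
Lemma preserves_herm_SU31 A :
  preserves_herm A -> exists2 k : C, k != 0 & SU31 (k *: A).
Proof.
move=> hA; have dA := det_preserves_herm hA.
have d0 : \det A != 0 by rewrite -normr_eq0 dA oner_neq0.
pose k := 4.-root (\det A)^-1.
have k4 : k ^+ 4 = (\det A)^-1 by rewrite rootCK.
have k1 : `|k| = 1.
  apply/eqP; rewrite -(@pexpr_eq1 _ _ 4) //.
  by rewrite -normrX k4 normfV dA invr1.
exists k; first by rewrite -normr_eq0 k1 oner_neq0.
split; first by rewrite detZ k4 mulVf.
move=> z w; rewrite -!scalemxAl !hermE hA mulrA -normCK k1 expr1n mul1r //.
Qed.

Lemma cols4_col (p : 'I_4 -> V) i : cols4 p *m delta_mx i 0 = p i.
Proof. by apply/colP=> j; rewrite -colE !mxE. Qed.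

Lemma herm_suml (I : finType) (c : I -> C) (p : I -> V) w :
  herm (\sum_i c i *: p i) w = \sum_i c i * herm (p i) w.
Proof.
rewrite (big_morph (fun t : V => herm t w) (fun u v => hermDl u v w) (herm0l w)).
by apply: eq_bigr => i _; rewrite hermZl.
Qed.

Lemma herm_sumr (I : finType) (c : I -> C) (p : I -> V) w :
  herm w (\sum_i c i *: p i) = \sum_i (c i)^* * herm w (p i).
Proof.
rewrite -[LHS]herm_conj herm_suml rmorph_sum.
by apply: eq_bigr => i _; rewrite rmorphM /= herm_conj.
Qed.

Lemma cols4_sum (p : 'I_4 -> V) (c : V) :
  cols4 p *m c = \sum_i c i 0 *: p i.
Proof.
apply/colP=> i; rewrite mxE summxE; apply: eq_bigr => j _.
by rewrite !mxE mulrC.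
Qed.

Lemma cols4_scale_unit (p : 'I_4 -> V) (k : 'I_4 -> C) :
  cols4 p \in unitmx -> (forall i, k i != 0) ->
  cols4 (fun i => k i *: p i) \in unitmx.
Proof.
move=> up k0.
have -> : cols4 (fun i => k i *: p i) = cols4 p *m diag_mx (\row_i k i).
  by rewrite mul_mx_diag; apply/matrixP => i j; rewrite !mxE mulrC.
rewrite unitmx_mul up unitmxE det_diag unitfE; apply/prodf_neq0 => i _.
by rewrite mxE.
Qed.

(** The map sending [k i *: p i] to [q i] preserves the form because the Gram matrices agree.
    Normalising its determinant introduces one more scalar, absorbed in [c]. *)
Lemma gram_isometry (p q : 'I_4 -> V) (k : 'I_4 -> C) :
  cols4 p \in unitmx -> cols4 q \in unitmx -> (forall i, k i != 0) ->
  (forall i j, k i * (k j)^* * herm (p i) (p j) = herm (q i) (q j)) ->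
  exists N c, [/\ SU31 N, forall i, c i != 0 & forall i, N *m p i = c i *: q i].
Proof.
move=> up uq k0 pq; pose kp i := k i *: p i.
have ukp : cols4 kp \in unitmx by apply: cols4_scale_unit.
have hpq (c d : V) : herm (cols4 kp *m c) (cols4 kp *m d)
                   = herm (cols4 q *m c) (cols4 q *m d).
  rewrite !cols4_sum !herm_suml; apply: eq_bigr => i _; congr (_ * _).
  rewrite !herm_sumr; apply: eq_bigr => j _.
  by congr (_ * _); rewrite /kp -pq hermZl hermZr mulrA.
have hN : preserves_herm (cols4 q *m invmx (cols4 kp)).
  by move=> z w; rewrite -!mulmxA -hpq !mulKVmx.
have [h h0 hk] := preserves_herm_SU31 hN.
exists (h *: (cols4 q *m invmx (cols4 kp))), (fun i => h / k i); split=> // i /=.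
  by rewrite mulf_neq0 ?invr_eq0.
have pE : p i = (k i)^-1 *: (cols4 kp *m delta_mx i 0).
  by rewrite cols4_col scalerA mulVf // scale1r.
by rewrite pE -scalemxAl -scalemxAr -mulmxA mulKmx // cols4_col scalerA.
Qed.

(** * Frames of two null vectors and an orthonormal basis of their complement *)

Definition hyperbolic_frame (a r x y : V) : Prop :=
  [/\ herm a a = 0, herm r r = 0, herm a r != 0 &
   [/\ herm x x = 1, herm y y = 1, herm x y = 0 &
    [/\ herm a x = 0, herm a y = 0, herm r x = 0 & herm r y = 0]]].

Lemma hyperbolic_frame_swap a r x y :
  hyperbolic_frame a r x y -> hyperbolic_frame a r y x.
Proof.
move=> [aa rr ar [xx yy xy [ax ay rx ry]]].
by split=> //; split=> //; rewrite -herm_conj xy conjC0.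
Qed.

Lemma hyperbolic_frame_basis a r x y : hyperbolic_frame a r x y -> basis4 a r x y.
Proof.
move=> [aa rr ar [xx yy xy [ax ay rx ry]]]; apply: basis4P => c0 c1 c2 c3 c.
have h w := congr1 (fun t : V => herm t w) c; move: (h r) (h a) (h x) (h y).
have ra : herm r a != 0 by rewrite herm_eq0_sym.
have [xa [ya [xr yr]]] :
    herm x a = 0 /\ herm y a = 0 /\ herm x r = 0 /\ herm y r = 0.
  by rewrite -![herm _ a]herm_conj -![herm _ r]herm_conj ax ay rx ry conjC0.
have yx : herm y x = 0 by rewrite -herm_conj xy conjC0.
rewrite !hermE !herm0l aa rr xx yy xy yx ax ay rx ry xa ya xr yr.
rewrite !mulr0 !mulr1 !addr0 !add0r => /eqP + /eqP.
by rewrite !mulf_eq0 (negPf ar) (negPf ra) !orbF => /eqP-> /eqP-> -> ->.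
Qed.

Lemma hyperbolic_frame_expand a r x y t : hyperbolic_frame a r x y ->
  t = herm t r / herm a r *: a + herm t a / herm r a *: r
      + herm t x *: x + herm t y *: y.
Proof.
move=> F; have B := hyperbolic_frame_basis F.
move: F => [aa rr ar [xx yy xy [ax ay rx ry]]].
have ra : herm r a != 0 by rewrite herm_eq0_sym.
have [xa [ya [xr yr]]] :
    herm x a = 0 /\ herm y a = 0 /\ herm x r = 0 /\ herm y r = 0.
  by rewrite -![herm _ a]herm_conj -![herm _ r]herm_conj ax ay rx ry conjC0.
have yx : herm y x = 0 by rewrite -herm_conj xy conjC0.
apply/eqP; rewrite -subr_eq0; apply/eqP; rewrite -scaleN1r.
apply: (basis4_orthogonal_eq0 B);
  rewrite !hermE ?aa ?rr ?xx ?yy ?xy ?yx ?ax ?ay ?rx ?ry ?xa ?ya ?xr ?yr;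
  by rewrite ?divfK // !mulr0 ?mulr1 ?addr0 ?add0r mulN1r subrr.
Qed.

(** Modulo the span of [a] and [r], the coordinates of [b] and [s] are their products with [x] and
    [y]; the hypothesis is the resulting 2 by 2 determinant. *)
Lemma basis4_of_frame a r x y b s : hyperbolic_frame a r x y ->
  herm b x * herm s y - herm b y * herm s x != 0 -> basis4 a r b s.
Proof.
move=> [aa rr ar [xx yy xy [ax ay rx ry]]] d0.
have ra : herm r a != 0 by rewrite herm_eq0_sym.
apply: basis4P => c0 c1 c2 c3 c; have h w := congr1 (fun t : V => herm t w) c.
move: (h x) (h y); rewrite !hermE !herm0l ax ay rx ry !mulr0 !add0r => hx hy.
have c20 : c2 = 0.
  apply: (mulIf d0); rewrite mul0r.
  transitivity ((c2 * herm b x + c3 * herm s x) * herm s y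
              - (c2 * herm b y + c3 * herm s y) * herm s x); first by ring.
  by rewrite hx hy !mul0r subrr.
have c30 : c3 = 0.
  apply: (mulIf d0); rewrite mul0r.
  transitivity ((c2 * herm b y + c3 * herm s y) * herm b x
              - (c2 * herm b x + c3 * herm s x) * herm b y); first by ring.
  by rewrite hx hy !mul0r subrr.
move: (h r) (h a); rewrite c20 c30 !hermE !herm0l aa rr.
rewrite !mulr0 !mul0r !addr0 ?add0r => /eqP + /eqP.
by rewrite !mulf_eq0 (negPf ar) (negPf ra) !orbF => /eqP-> /eqP->.
Qed.

(* Cartan's angular invariant of three null vectors lies strictly between
   -pi/2 and pi/2 unless they are linearly dependent. *)
Lemma triple_product_lt0 a r x y b : hyperbolic_frame a r x y ->
  herm b b = 0 -> (herm b x != 0) || (herm b y != 0) ->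
  forall T, T = herm a b * (herm r b)^* * (herm a r)^* -> T + T^* < 0.
Proof.
move=> F bb bxy T TE; have bE := hyperbolic_frame_expand b F.
move: F => [_ _ ar _].
have ra : herm r a != 0 by rewrite herm_eq0_sym.
(* Pairing the expansion of the null vector [b] with [b] and multiplying by the squared modulus of
   [herm a r] gives [T + T^*] plus that modulus times [n] equal to 0. *)
have := congr1 (fun t : V => herm t b) bE; rewrite /= bb !hermE => e.
pose n := herm b x * (herm b x)^* + herm b y * (herm b y)^*.
have n0 : 0 < n.
  rewrite lt_neqAle addr_ge0 ?mul_conjC_ge0 // andbT eq_sym.
  by apply: contraL bxy => /eqP/sum_mulconj_eq0[-> ->]; rewrite eqxx.
have -> : T + T^* = - (herm a r * (herm a r)^* * n).
  rewrite TE !rmorphM /= !conjCK !herm_conj /n !herm_conj.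
  apply/eqP; rewrite -addr_eq0; apply/eqP.
  transitivity (herm a r * herm r a * 0); last by rewrite mulr0.
  by rewrite {1}e; field; rewrite ar ra.
by rewrite oppr_lt0 mulr_gt0 ?mul_conjC_gt0.
Qed.

(** A vanishing determinant puts both pairs on one line of C^2. A generator of length one is wanted
    because it will be the positive unit vector of a copy of C^{2,1}. *)
Lemma unit_direction (b1 b2 s1 s2 : C) : b1 * s2 - b2 * s1 = 0 ->
  exists n1 n2, n1 * n1^* + n2 * n2^* = 1 /\
    exists k l, [/\ b1 = k * n1, b2 = k * n2, s1 = l * n1 & s2 = l * n2].
Proof.
have normalise (c1 c2 : C) : (c1 != 0) || (c2 != 0) ->
    exists2 k, k != 0 & (c1 / k) * (c1 / k)^* + (c2 / k) * (c2 / k)^* = 1.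
  move=> c12; pose n := c1 * c1^* + c2 * c2^*.
  have n0 : 0 < n.
    rewrite lt_neqAle addr_ge0 ?mul_conjC_ge0 // andbT eq_sym.
    by apply: contraL c12 => /eqP/sum_mulconj_eq0[-> ->]; rewrite eqxx.
  have k0 : sqrtC n != 0 by rewrite gt_eqF // sqrtC_gt0.
  have kc : (sqrtC n)^* = sqrtC n by apply/CrealP; rewrite gtr0_real // sqrtC_gt0.
  exists (sqrtC n) => //.
  rewrite !(rmorphM, fmorphV) /= kc.
  transitivity (n / sqrtC n ^+ 2); first by rewrite /n; field.
  by rewrite sqrtCK divff // gt_eqF.
move=> d0; have d : b1 * s2 = b2 * s1 by apply/eqP; rewrite -subr_eq0 d0.
have [b0|b0] := boolP ((b1 != 0) || (b2 != 0)).
  have [k k0 nk] := normalise _ _ b0.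
  exists (b1 / k), (b2 / k); split=> //; have [z|b10] := eqVneq b1 0.
    rewrite z eqxx /= in b0; move: d; rewrite z mul0r => /esym/eqP.
    rewrite mulf_eq0 (negPf b0) /= => /eqP ->.
    exists k, (s2 * k / b2); rewrite !mul0r ?mulr0; split=> //; by field; rewrite ?k0 ?b0.
  exists k, (s1 * k / b1); split; try by field; rewrite ?k0 ?b10.
  have -> : s2 = b2 * s1 / b1 by rewrite -d; field.
  by field; rewrite k0 b10.
move: b0; rewrite negb_or !negbK => /andP[/eqP-> /eqP->].
have [s0|] := boolP ((s1 != 0) || (s2 != 0)).
  have [k k0 nk] := normalise _ _ s0.
  exists (s1 / k), (s2 / k); split=> //; exists 0, k.
  by rewrite !mul0r; split=> //; field.
rewrite negb_or !negbK => /andP[/eqP-> /eqP->].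
(* Both pairs vanish here, so any unit vector serves. *)
exists 1, 0; rewrite conjC1 conjC0 mulr0 addr0 mulr1; split=> //.
by exists 0, 0; rewrite !mul0r.
Qed.

(** The components of [b] and [s] orthogonal to [a] and [r] are multiples of one unit vector [n], so
    all four vectors lie in the span of [a], [n], [r]. *)
Lemma chain_through_frame a r x y b s : hyperbolic_frame a r x y ->
  herm b x * herm s y - herm b y * herm s x = 0 ->
  exists2 E : 'M[C]_(4, 3), C21_embedding E &
    forall v, v \in [:: a; r; b; s] -> exists z : 'cV_3, v = E *m z.
Proof.
move=> F d0; have [n1 [n2 [n12 [k [l [bx by_ sx sy]]]]]] := unit_direction d0.
have bE := hyperbolic_frame_expand b F; have sE := hyperbolic_frame_expand s F.
move: F => [aa rr ar [xx yy xy [ax ay rx ry]]].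
have ra : herm r a != 0 by rewrite herm_eq0_sym.
have [xa [ya [xr yr]]] :
    herm x a = 0 /\ herm y a = 0 /\ herm x r = 0 /\ herm y r = 0.
  by rewrite -![herm _ a]herm_conj -![herm _ r]herm_conj ax ay rx ry conjC0.
have yx : herm y x = 0 by rewrite -herm_conj xy conjC0.
have [n nE] : exists n, n = n1 *: x + n2 *: y by exists (n1 *: x + n2 *: y).
(* The rescaling gives [herm a r1 = 1], as [herm21] requires of its outer basis vectors. *)
have [r1 r1E] : exists r1, r1 = (herm r a)^-1 *: r by exists ((herm r a)^-1 *: r).
pose E : 'M[C]_(4, 3) := \matrix_(i, j) tnth [tuple a; n; r1] j i 0.
have EE (z : 'cV_3) : E *m z = z 0 0 *: a + z 1 0 *: n + z 2 0 *: r1.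
  apply/colP=> i; rewrite !mxE !big_ord_recl big_ord0 !mxE addr0 !addrA.
  rewrite !(tnth_nth 0) /=.
  have -> : lift ord0 (lift ord0 ord0) = 2 :> 'I_3 by apply: val_inj.
  have -> : lift ord0 ord0 = 1 :> 'I_3 by apply: val_inj.
  by rewrite ![_ * z _ _]mulrC.
have onE (c0 c1 c2 : C) : exists z : 'cV_3, c0 *: a + c1 *: n + c2 *: r = E *m z.
  exists (\col_i tnth [tuple c0; c1; c2 * herm r a] i).
  by rewrite EE !mxE /= !(tnth_nth 0) /= r1E scalerA mulfK.
have herm_n w : herm w n = n1^* * herm w x + n2^* * herm w y.
  by rewrite nE hermDr !hermZr.
have herm_r1 w : herm w r1 = (herm a r)^-1 * herm w r.
  by rewrite r1E hermZr fmorphV /= herm_conj.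
have an : herm a n = 0 by rewrite herm_n ax ay !mulr0 addr0.
have na : herm n a = 0 by rewrite -herm_conj an conjC0.
have nr1 : herm n r1 = 0.
  by rewrite herm_r1 nE hermDl !hermZl xr yr !mulr0 addr0 mulr0.
have r1n : herm r1 n = 0 by rewrite -herm_conj nr1 conjC0.
have ar1 : herm a r1 = 1 by rewrite herm_r1 mulVf.
have r1a : herm r1 a = 1 by rewrite -herm_conj ar1 conjC1.
have r1r1 : herm r1 r1 = 0 by rewrite herm_r1 r1E hermZl rr !mulr0.
have nn : herm n n = 1.
  rewrite herm_n nE !hermDl !hermZl xx yy xy yx !mulr0 !mulr1 addr0 add0r.
  by rewrite mulrC [n2^* * _]mulrC.
exists E.
  move=> z w; rewrite !EE /herm21.
  rewrite !hermDl !hermZl !hermDr !hermZr aa an ar1 na nn nr1 r1a r1n r1r1.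
  by rewrite !mulr0 !addr0 !add0r !mulr1.
move=> v; rewrite !inE => /or4P[] /eqP ->.
- by have [z zE] := onE 1 0 0; exists z; rewrite -zE scale1r !scale0r !addr0.
- by have [z zE] := onE 0 0 1; exists z; rewrite -zE scale1r !scale0r !add0r.
- have [z zE] := onE (herm b r / herm a r) k (herm b a / herm r a).
  exists z; rewrite -zE {1}bE bx by_ nE scalerDr !scalerA.
  by rewrite -!addrA; congr (_ + _); rewrite addrC -!addrA.
- have [z zE] := onE (herm s r / herm a r) l (herm s a / herm r a).
  exists z; rewrite -zE {1}sE sx sy nE scalerDr !scalerA.
  by rewrite -!addrA; congr (_ + _); rewrite addrC -!addrA.
Qed.

(** * Boundary fixed points and the action of an isometry on frames *)

Lemma loxodromic_bd_fixed A a r : loxodromic A ->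
  bd_fixed A a -> bd_fixed A r -> herm a r != 0 ->
  forall w, bd_fixed A w -> exists k, w = k *: a \/ w = k *: r.
Proof.
move=> [_ _ [u [v [Au Av _ H]]]] Aa Ar ar w Aw.
have [[[_ nu] _] [[_ nv] _]] := (Au, Av).
have col t s : same_point t s -> forall q, same_point q s -> exists k, q = k *: t.
  move=> [c c0 ->] q [d _ ->]; exists (d / c); by rewrite scalerA divfK.
(* Null lifts of one point are orthogonal, so [herm a r != 0] places [a] and [r] over different
   fixed points. *)
have absurd t : herm t t = 0 -> same_point a t -> same_point r t -> False.
  move=> nt [c _ Ea] [d _ Er]; move: ar; rewrite Ea Er !hermE nt !mulr0.
  by rewrite eqxx.
case: (H a Aa) (H r Ar) (H w Aw) => [a1|a1] [r1|r1].
- by case: (absurd u).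
- case=> w1; first by have [k ->] := col _ _ a1 _ w1; exists k; left.
  by have [k ->] := col _ _ r1 _ w1; exists k; right.
- case=> w1; first by have [k ->] := col _ _ r1 _ w1; exists k; right.
  by have [k ->] := col _ _ a1 _ w1; exists k; left.
- by case: (absurd v).
Qed.

(* The [beta]-invariant gives the ratio of the products of [p] with [b] and
   [s], hence a fourth independent linear condition on the line of [p]. *)
Lemma isometry_polar_vector N ka kr kb ks a r b s p a' r' b' s' p' :
  preserves_herm N -> [/\ ka != 0, kr != 0, kb != 0 & ks != 0] ->
  [/\ N *m a = ka *: a', N *m r = kr *: r', N *m b = kb *: b' & N *m s = ks *: s'] ->
  basis4 a' r' b' s' ->
  herm p a = 0 -> herm p r = 0 -> herm p' a' = 0 -> herm p' r' = 0 ->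
  [/\ herm a b != 0, herm a s != 0, herm p b != 0 & herm p' b' != 0] ->
  cross s b p a = cross s' b' p' a' ->
  exists e, N *m p = e *: p'.
Proof.
move=> hN [ka0 kr0 kb0 ks0] [Na Nr Nb Ns] B pa pr pa' pr' [ab as_ pb pb'] X.
have NpE k w w' : k != 0 -> N *m w = k *: w' -> herm (N *m p) w' = herm p w / k^*.
  move=> k0 Nw; rewrite -[herm p w]hN Nw hermZr mulrC mulKf //.
  by rewrite conjC_eq0.
have abE : herm a b = ka * kb^* * herm a' b'.
  by rewrite -[LHS]hN Na Nb hermZl hermZr mulrA.
have asE : herm a s = ka * ks^* * herm a' s'.
  by rewrite -[LHS]hN Na Ns hermZl hermZr mulrA.
have ab' : herm a' b' != 0 by apply: contraNneq ab; rewrite abE => ->; rewrite mulr0.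
have as' : herm a' s' != 0 by apply: contraNneq as_; rewrite asE => ->; rewrite mulr0.
have [kbc ksc] : kb^* != 0 /\ ks^* != 0 by rewrite !conjC_eq0.
have psE : herm p s = ks^* * herm p b / (kb^* * herm p' b') * herm p' s'.
  have -> : herm p s = cross s b p a * (herm a s * herm p b) / herm a b.
    by rewrite /cross; field; rewrite ab as_ pb.
  by rewrite X /cross abE asE; field; rewrite ab' as' pb' ka0 kbc.
(* This value makes [N *m p - e *: p'] orthogonal to [b']. The cross-ratio, solved for [herm p s],
   gives orthogonality to [s']; for [a'] and [r'] it comes from polarity. *)
pose e := herm p b / (kb^* * herm p' b').
exists e; apply/eqP; rewrite -subr_eq0 -scaleNr; apply/eqP.
apply: (basis4_orthogonal_eq0 B); rewrite hermDl hermZl.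
- by rewrite (NpE _ _ _ ka0 Na) pa pa' mul0r mulr0 addr0.
- by rewrite (NpE _ _ _ kr0 Nr) pr pr' mul0r mulr0 addr0.
- by rewrite (NpE _ _ _ kb0 Nb) /e; field; rewrite pb' kbc.
- by rewrite (NpE _ _ _ ks0 Ns) psE /e; field; rewrite pb' kbc ksc.
Qed.

Definition eigen4 A l1 l2 mu nu (a r x y : V) : Prop :=
  [/\ A *m a = l1 *: a, A *m r = l2 *: r, A *m x = mu *: x & A *m y = nu *: y].

(** An isometry respects orthogonal complements, so [q] goes to a multiple of [q']. The two products
    then agree on a basis, since corresponding frame vectors have the same eigenvalue. *)
Lemma conjugacy_of_frames N A A' ka kr e l1 l2 mu nu a r p q a' r' p' q' :
  preserves_herm N -> ka != 0 -> kr != 0 ->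
  hyperbolic_frame a r p q -> hyperbolic_frame a' r' p' q' ->
  eigen4 A l1 l2 mu nu a r p q -> eigen4 A' l1 l2 mu nu a' r' p' q' ->
  N *m a = ka *: a' -> N *m r = kr *: r' -> N *m p = e *: p' -> N *m A = A' *m N.
Proof.
move=> hN ka0 kr0 F F' [Aa Ar Ap Aq] [Aa' Ar' Ap' Aq'] Na Nr Np.
have [f Nq] : exists f, N *m q = f *: q'.
  have [_ _ _ [pp _ pq [_ aq _ rq]]] := F.
  have e0 : e != 0.
    apply/eqP => e0; have := hN p p; rewrite Np e0 scale0r herm0l pp => /esym/eqP.
    by rewrite oner_eq0.
  have orth w w' c : c != 0 -> N *m w = c *: w' -> herm w q = 0 -> herm (N *m q) w' = 0.
    move=> c0 Nw wq; have := hN w q; rewrite Nw wq hermZl => /eqP.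
    by rewrite mulf_eq0 (negPf c0) herm_eq0_sym => /eqP.
  exists (herm (N *m q) q'); rewrite {1}(hyperbolic_frame_expand (N *m q) F').
  rewrite (orth _ _ _ ka0 Na aq) (orth _ _ _ kr0 Nr rq) (orth _ _ _ e0 Np pq).
  by rewrite !mul0r !scale0r !add0r.
apply: (basis4_eq (hyperbolic_frame_basis F)); rewrite -!mulmxA.
- by rewrite Aa Na -!scalemxAr Na Aa' !scalerA mulrC.
- by rewrite Ar Nr -!scalemxAr Nr Ar' !scalerA mulrC.
- by rewrite Ap Np -!scalemxAr Np Ap' !scalerA mulrC.
- by rewrite Aq Nq -!scalemxAr Nq Aq' !scalerA mulrC.
Qed.

(** * The spectrum of a loxodromic element *)

Lemma expiD (s t : R) : expi (s + t) = expi s * expi t.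
Proof. by rewrite /expi cosD sinD [sin s * _ + _]addrC. Qed.

Lemma expiN (t : R) : expi (- t) = (expi t)^*.
Proof. by rewrite /expi cosN sinN. Qed.

Lemma expi0 : expi 0 = 1 :> C.
Proof. by rewrite /expi cos0 sin0. Qed.

Lemma expi_conj (t : R) : expi t * (expi t)^* = 1.
Proof. by rewrite -expiN -expiD subrr expi0. Qed.

Lemma real_complex_conj (t : R) : ((t%:C)%C : C)^* = (t%:C)%C.
Proof. exact: conjc_real. Qed.

Definition loxodromic_spectrum (l1 l2 mu nu : C) : Prop :=
  [/\ 1 < l1 * l1^*, l2 * l1^* = 1, mu * mu^* = 1, nu * nu^* = 1
    & l1 * l2 * mu * nu = 1].

Lemma loxodromic_spectrum_expi (r theta phi : R) : 1 < r ->
  loxodromic_spectrum ((r%:C)%C * expi theta) ((r^-1%:C)%C * expi theta)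
    (expi phi) (expi (- (2 * theta + phi))).
Proof.
move=> r1; have r0 : r != 0 by rewrite gt_eqF // (lt_trans ltr01).
have rV : (r%:C)%C * (r^-1%:C)%C = 1 :> C by rewrite -rmorphM /= divff.
split; rewrite ?expi_conj //.
- rewrite rmorphM /= real_complex_conj mulrACA expi_conj mulr1 -rmorphM /=.
  by rewrite -[1]/((1 : R)%:C)%C ltcR -expr2 exprn_egt1.
- by rewrite rmorphM /= real_complex_conj mulrACA expi_conj mulr1 mulrC.
- rewrite mulrACA rV mul1r -!expiD.
  by rewrite (_ : _ + _ = 0) ?expi0 //; ring.
Qed.

(** Inversion in the unit circle swaps [l1] and [l2] and fixes [mu] and [nu]. The conjugate of the
    sum is therefore the sum of the inverses, which is the third elementary symmetric function
    because the product is 1. *)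
Lemma spectrum_poly l1 l2 mu nu t : loxodromic_spectrum l1 l2 mu nu ->
  let s := l1 + l2 + mu + nu in
  let q := l1 ^+ 2 + l2 ^+ 2 + mu ^+ 2 + nu ^+ 2 in
  (t - l1) * (t - l2) * (t - mu) * (t - nu) =
  t ^+ 4 - s * t ^+ 3 + 2^-1 * (s ^+ 2 - q) * t ^+ 2 - s^* * t + 1.
Proof.
move=> [_ l21 m1 n1 d] s q.
have uniq_inv (x y z : C) : x * z = 1 -> y * z = 1 -> x = y.
  move=> xz yz; have z0 : z != 0.
    by apply/eqP => z0; move/eqP: xz; rewrite z0 mulr0 eq_sym oner_eq0.
  by apply: (mulIf z0); rewrite xz yz.
have l1c : l1^* = l1 * mu * nu by apply: (uniq_inv _ _ l2); rewrite 1?mulrC // -d; ring.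
have l2c : l2^* = l2 * mu * nu.
  apply: (uniq_inv _ _ l1); last by rewrite -d; ring.
  by rewrite -[l1]conjCK -rmorphM l21 rmorph1.
have muc : mu^* = l1 * l2 * nu by apply: (uniq_inv _ _ mu); rewrite 1?mulrC // -d; ring.
have nuc : nu^* = l1 * l2 * mu by apply: (uniq_inv _ _ nu); rewrite 1?mulrC // -d; ring.
by rewrite -[X in _ = _ + X]d /s /q !rmorphD /= l1c l2c muc nuc; field.
Qed.

(* The first eigenvalue is the only one outside the closed unit disc, and the
   labelling convention settles the choice among the other two. *)
Lemma spectrum_uniq l1 l2 mu nu l1' l2' nu' :
  loxodromic_spectrum l1 l2 mu nu -> loxodromic_spectrum l1' l2' mu nu' ->
  (forall t, ((t - l1) * (t - l2) * (t - mu) * (t - nu) == 0) =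
             ((t - l1') * (t - l2') * (t - mu) * (t - nu') == 0)) ->
  [/\ l1 = l1', l2 = l2' & nu = nu'].
Proof.
move=> [l1n l21 m1 n1 d] [l1n' l21' m1' n1' d'] e.
have l1E : l1 = l1'.
  move: (e l1); rewrite subrr !mul0r eqxx => /esym.
  rewrite !mulf_eq0 !subr_eq0 => /orP[/orP[/orP[]|]|] /eqP // E.
  (* If [l1] were [l2'], the inversion of [l1'], the squared moduli of [l1] and [l1'] would be
     inverse to each other, yet both exceed 1. *)
  - have : (l1' * l1'^*) * (l1 * l1^*) = 1.
      rewrite E; transitivity ((l2' * l1'^*) * (l2' * l1'^*)^*); last first.
        by rewrite l21' conjC1 mulr1.
      by rewrite rmorphM /= conjCK; ring.
    have := mulr_egt1 l1n' l1n => /[swap] ->; by rewrite ltxx.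
  - by move: l1n; rewrite E m1 ltxx.
  - by move: l1n; rewrite E n1' ltxx.
have l1c0 : l1^* != 0.
  by apply/eqP => z; move/eqP: l21; rewrite z mulr0 eq_sym oner_eq0.
have l2E : l2 = l2' by apply: (mulIf l1c0); rewrite l21 l1E l21'.
split=> //; apply: (@mulfI _ (l1 * l2 * mu)); last by rewrite d l1E l2E d'.
by apply/eqP => z; move/eqP: d; rewrite z mul0r eq_sym oner_eq0.
Qed.

(** * Trace and eigenvalues read off from an eigenbasis *)

Lemma mxtrace_eigenbasis A (p : 'I_4 -> V) (l : 'I_4 -> C) :
  cols4 p \in unitmx -> (forall i, A *m p i = l i *: p i) -> \tr A = \sum_i l i.
Proof.
move=> up Ap; pose D : M := diag_mx (\row_i l i).
have AE : A *m cols4 p = cols4 p *m D.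
  rewrite mul_mx_diag; apply/matrixP => i j; have := congr1 (fun v : V => v i 0) (Ap j).
  rewrite !mxE => E; transitivity (l j * p j i 0).
    by rewrite -E; apply: eq_bigr => k _; rewrite mxE.
  by rewrite mulrC.
rewrite -[A](mulmxK up) AE mxtrace_mulC mulKmx // mxtrace_diag.
by apply: eq_bigr => i _; rewrite mxE.
Qed.

(** [eigenvalue] refers to row eigenvectors while [p] consists of columns; the determinant of
    [t%:M - A] links the two. *)
Lemma eigenvalue_eigenbasis A (p : 'I_4 -> V) (l : 'I_4 -> C) t :
  cols4 p \in unitmx -> (forall i, A *m p i = l i *: p i) ->
  eigenvalue A t = (\prod_i (t - l i) == 0).
Proof.
move=> up Ap; pose D : M := diag_mx (\row_i (t - l i)).
have AE : (t%:M - A) *m cols4 p = cols4 p *m D.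
  rewrite mul_mx_diag; apply/matrixP => i j; have := congr1 (fun v : V => v i 0) (Ap j).
  rewrite mulmxBl mul_scalar_mx !mxE => E.
  transitivity (t * p j i 0 - l j * p j i 0).
    by rewrite -E; congr (_ - _); apply: eq_bigr => k _; rewrite mxE.
  by rewrite -mulrBl mulrC.
have <- : \det (t%:M - A) = \prod_i (t - l i).
  rewrite -[_ - A](mulmxK up) AE !det_mulmx det_inv mulrAC mulfV -?unitfE -?unitmxE //.
  by rewrite mul1r det_diag; apply: eq_bigr => i _; rewrite mxE.
apply/eigenvalueP/det0P => [[v vA v0]|[v v0 vA]]; exists v => //.
  by rewrite mulmxBr vA mul_mx_scalar subrr.
by move/eqP: vA; rewrite mulmxBr mul_mx_scalar subr_eq0 => /eqP.
Qed.

Lemma eigen4_vec4 A l1 l2 mu nu a r x y : eigen4 A l1 l2 mu nu a r x y ->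
  forall i, A *m vec4 a r x y i = tnth [tuple l1; l2; mu; nu] i *: vec4 a r x y i.
Proof.
by move=> [Aa Ar Ax Ay] [[|[|[|[|//]]]] i]; rewrite /vec4 !(tnth_nth 0).
Qed.

Lemma eigen4_trace A l1 l2 mu nu a r x y : basis4 a r x y ->
  eigen4 A l1 l2 mu nu a r x y -> \tr A = l1 + l2 + mu + nu.
Proof.
move=> B E; rewrite (mxtrace_eigenbasis B (eigen4_vec4 E)).
by rewrite !big_ord_recl big_ord0 !(tnth_nth 0) /= addr0 !addrA.
Qed.

Lemma eigen4_trace_sqr A l1 l2 mu nu a r x y : basis4 a r x y ->
  eigen4 A l1 l2 mu nu a r x y ->
  \tr (A *m A) = l1 ^+ 2 + l2 ^+ 2 + mu ^+ 2 + nu ^+ 2.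
Proof.
move=> B [Aa Ar Ax Ay]; apply: (eigen4_trace B).
by split; rewrite -mulmxA ?(Aa, Ar, Ax, Ay) -scalemxAr ?(Aa, Ar, Ax, Ay) scalerA.
Qed.

Lemma eigen4_eigenvalue A l1 l2 mu nu a r x y : basis4 a r x y ->
  eigen4 A l1 l2 mu nu a r x y -> forall t,
  eigenvalue A t = ((t - l1) * (t - l2) * (t - mu) * (t - nu) == 0).
Proof.
move=> B E t; rewrite (eigenvalue_eigenbasis t B (eigen4_vec4 E)).
by rewrite !big_ord_recl big_ord0 !(tnth_nth 0) /= mulr1 !mulrA.
Qed.

(** * Frames of marked loxodromic elements *)

Lemma eigenvectors_orthogonal A l k v w : preserves_herm A ->
  A *m v = l *: v -> A *m w = k *: w -> l * k^* != 1 -> herm v w = 0.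
Proof.
move=> hA Av Aw; apply: contraNeq => vw.
by have := hA v w; rewrite Av Aw hermZl hermZr mulrA => /(canRL (mulfK vw)) ->; rewrite divff.
Qed.

(** Moduli of eigenvalues separate the null eigenvectors from the positive ones. If [a] and [rep]
    were orthogonal they would be proportional, and their eigenvalues would coincide. *)
Lemma eigenframe_hyperbolic A r theta phi a rep x y : SU31 A ->
  eigenframe A r theta phi a rep x y -> hyperbolic_frame a rep x y.
Proof.
move=> [_ hA] [[r1 _ _] [[na Aa] [nr Ar] [xx Ax] [yy Ay] xy]].
have [l1n l21 m1 n1 _] := loxodromic_spectrum_expi theta phi r1.
set l1 := _ * _ in Aa l1n l21; set l2 := _ * _ in Ar l21.
have l1c0 : l1^* != 0.
  by apply/eqP => z; move/eqP: l21; rewrite z mulr0 eq_sym oner_eq0.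
have l1mod t : t * t^* = 1 -> l1 <> t by move=> t1 E; move: l1n; rewrite E t1 ltxx.
have l2mod t : t * t^* = 1 -> l2 <> t.
  move=> t1 E; apply: (l1mod t) => //; apply: (inv_inj (@conjCK C)).
  have t0 : t != 0 by apply/eqP => z; move/eqP: t1; rewrite z mul0r eq_sym oner_eq0.
  by apply: (mulfI t0); rewrite t1 -E l21.
have orth v l t w : A *m v = l *: v -> (forall k, k * k^* = 1 -> l <> k) ->
    A *m w = t *: w -> t * t^* = 1 -> herm v w = 0.
  move=> Av lk Aw t1; apply: (eigenvectors_orthogonal hA Av Aw).
  apply/eqP => E; apply: (lk t t1).
  have t0 : t^* != 0 by apply/eqP => z; move/eqP: t1; rewrite z mulr0 eq_sym oner_eq0.
  by apply: (mulIf t0); rewrite E t1.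
have [[a0 aa] [r0 rr]] := (na, nr).
split=> //.
  apply/eqP => ar; have [k E] := orthogonal_null_colinear na nr ar.
  have l12 : l1 = l2.
    apply/eqP; rewrite -subr_eq0; have : (l1 - l2) *: rep = 0.
      by rewrite scalerBl -Ar E -scalemxAr Aa !scalerA mulrC subrr.
    by move/eqP; rewrite scaler_eq0 (negPf r0) orbF.
  by apply: (l1mod l1) => //; rewrite {1}l12.
split=> //; split.
- exact: orth Aa l1mod Ax m1.
- exact: orth Aa l1mod Ay n1.
- exact: orth Ar l2mod Ax m1.
- exact: orth Ar l2mod Ay n1.
Qed.

Lemma eigenframe_eigen4 A r theta phi a rep x y :
  eigenframe A r theta phi a rep x y ->
  eigen4 A ((r%:C)%C * expi theta) ((r^-1%:C)%C * expi theta)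
    (expi phi) (expi (- (2 * theta + phi))) a rep x y.
Proof. by move=> [_ [[_ Aa] [_ Ar] [_ Ax] [_ Ay] _]]. Qed.

Lemma marked_frames (m : marking R) A A' (i : 'I_2) :
  loxodromic A -> loxodromic A' -> \tr A = \tr A' -> sigma A = sigma A' ->
  exists l1 l2 mu nu q q',
    [/\ hyperbolic_frame (att m A) (rpl m A) (pvec m i A) q,
        hyperbolic_frame (att m A') (rpl m A') (pvec m i A') q',
        eigen4 A l1 l2 mu nu (att m A) (rpl m A) (pvec m i A) q &
        eigen4 A' l1 l2 mu nu (att m A') (rpl m A') (pvec m i A') q'].
Proof.
move=> loxA loxA' trE sE.
have [[SA _ _] [SA' _ _]] := (loxA, loxA').
have [FA FA'] := (eigenframeP m loxA, eigenframeP m loxA').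
have [HA HA'] := (eigenframe_hyperbolic SA FA, eigenframe_hyperbolic SA' FA').
have [EA EA'] := (eigenframe_eigen4 FA, eigenframe_eigen4 FA').
have [BA BA'] := (hyperbolic_frame_basis HA, hyperbolic_frame_basis HA').
have [[[r1 _ _] _] [[r1' _ _] _]] := (FA, FA').
have LA := loxodromic_spectrum_expi (theta_of m A) (phi_of m A) r1.
have LA' := loxodromic_spectrum_expi (theta_of m A') (phi_of m A') r1'.
have tr2E : \tr (A *m A) = \tr (A' *m A').
  move: sE; rewrite /sigma trE => /mulfI; rewrite invr_eq0 pnatr_eq0 => /(_ isT).
  by move/addrI/oppr_inj.
have polyE t : ((t - (mod_of m A)%:C%C * expi (theta_of m A))
    * (t - (mod_of m A)^-1%:C%C * expi (theta_of m A))
    * (t - expi (phi_of m A)) * (t - expi (- (2 * theta_of m A + phi_of m A))) == 0)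
  = ((t - (mod_of m A')%:C%C * expi (theta_of m A'))
    * (t - (mod_of m A')^-1%:C%C * expi (theta_of m A'))
    * (t - expi (phi_of m A')) * (t - expi (- (2 * theta_of m A' + phi_of m A'))) == 0).
  rewrite (spectrum_poly t LA) (spectrum_poly t LA').
  rewrite -(eigen4_trace BA EA) -(eigen4_trace BA' EA').
  by rewrite -(eigen4_trace_sqr BA EA) -(eigen4_trace_sqr BA' EA') trE tr2E.
(* Equal polynomials give equal sets of eigenvalues, so the labelling convention applies. This
   supplies the common [mu] on which [spectrum_uniq] relies. *)
have phiE : phi_of m A = phi_of m A'.
  apply: phi_ofP loxA loxA' _ => t.
  by rewrite (eigen4_eigenvalue BA EA) (eigen4_eigenvalue BA' EA') polyE.
rewrite -phiE in EA' LA' polyE.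
have [e1 e2 e3] := spectrum_uniq LA LA' polyE.
rewrite -e1 -e2 -e3 in EA'.
have [[Aa Ar Ax Ay] [Aa' Ar' Ax' Ay']] := (EA, EA').
rewrite /pvec; case: ifP => _.
  by do 4!eexists; exists (yvec m A), (yvec m A'); split; eassumption.
(* For the second label, [x] and [y] trade places, and so do their eigenvalues. *)
do 4!eexists; exists (xvec m A), (xvec m A').
by split; [exact: hyperbolic_frame_swap|exact: hyperbolic_frame_swap|
  split; eassumption..].
Qed.

(** * General position of the fixed points of a non-singular pair *)

Lemma disjoint_bd_fixed_herm A B v w : (bd_fixed A `&` bd_fixed B = set0)%classic ->
  bd_fixed A v -> bd_fixed B w -> herm v w != 0.
Proof.
move=> AB Av [nw [c Bw]]; apply/eqP => vw.
(* Orthogonal null vectors represent the same point, which would be fixed by both [A] and [B]. *)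
have [nv _] := Av; have [k wE] := orthogonal_null_colinear nv nw vw.
suff : (bd_fixed A `&` bd_fixed B)%classic v by rewrite AB.
split=> //; split=> //; exists c.
have k0 : k != 0 by apply/eqP => k0; case: nw; rewrite wE k0 scale0r eqxx.
have -> : v = k^-1 *: w by rewrite wE scalerA mulVf // scale1r.
by rewrite -scalemxAr Bw !scalerA mulrC.
Qed.

Definition general_position (a r b s : V) : Prop :=
  [/\ [/\ herm a r != 0, herm a b != 0, herm a s != 0 &
          [/\ herm r b != 0, herm r s != 0 & herm b s != 0]],
      basis4 a r b s &
      let T := herm a b * (herm r b)^* * (herm a r)^* in T + T^* < 0].

Lemma bd_fixed_att (m : marking R) A : loxodromic A -> bd_fixed A (att m A).
Proof. by move=> /(eigenframeP m) [_ [[na Aa] _ _ _ _]]; split=> //; eexists; exact: Aa. Qed.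

Lemma bd_fixed_rpl (m : marking R) A : loxodromic A -> bd_fixed A (rpl m A).
Proof. by move=> /(eigenframeP m) [_ [_ [nr Ar] _ _ _]]; split=> //; eexists; exact: Ar. Qed.

Lemma nonsingular_general_position (m : marking R) A B :
  loxodromic A -> loxodromic B -> nonsingular_pair m A B ->
  general_position (att m A) (rpl m A) (att m B) (rpl m B).
Proof.
move=> loxA loxB [AB coplanar _ _].
have [[SA _ _] [SB _ _]] := (loxA, loxB).
have FA := eigenframe_hyperbolic SA (eigenframeP m loxA).
have [_ _ bs _] := eigenframe_hyperbolic SB (eigenframeP m loxB).
have [_ _ ar _] := FA.
have [fa fr] := (bd_fixed_att m loxA, bd_fixed_rpl m loxA).
have [fb fs] := (bd_fixed_att m loxB, bd_fixed_rpl m loxB).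
(* The determinant of the components of the fixed points of [B] in the positive plane of [A]; its
   vanishing would put all four fixed points on one chain. *)
pose d := herm (att m B) (xvec m A) * herm (rpl m B) (yvec m A)
        - herm (att m B) (yvec m A) * herm (rpl m B) (xvec m A).
have d0 : d != 0.
  apply/eqP => d0; apply: coplanar.
  have [E hE inE4] := chain_through_frame FA d0.
  pose S : set V := [set v | null v /\ exists z : 'cV[C]_3, v = E *m z]%classic.
  (* [bd_fixed] contains every lift of a fixed point, so all multiples of the four vectors have to
     lie in the chain. *)
  have scaleE v k : v \in [:: att m A; rpl m A; att m B; rpl m B] ->
      exists z : 'cV[C]_3, k *: v = E *m z.
    by move=> /inE4 [z ->]; exists (k *: z); rewrite scalemxAr.
  exists S; first by exists E.
  move=> w [] fw; (split; first by case: fw).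
    by have [k [->|->]] := loxodromic_bd_fixed loxA fa fr ar fw;
      apply: scaleE; rewrite !inE eqxx ?orbT.
  by have [k [->|->]] := loxodromic_bd_fixed loxB fb fs bs fw;
    apply: scaleE; rewrite !inE eqxx ?orbT.
split.
- by split=> //; [| | split=> //]; apply: disjoint_bd_fixed_herm AB _ _.
- exact: basis4_of_frame FA d0.
- apply: (triple_product_lt0 FA) => //; first by case: fb => [[]].
  apply: contraNT d0; rewrite negb_or !negbK /d => /andP[/eqP-> /eqP->].
  by rewrite !mul0r subrr.
Qed.

(** * Matching two pairs by an isometry *)

Lemma general_position_isometry a r b s a' r' b' s' :
  [/\ null a, null r, null b & null s] -> [/\ null a', null r', null b' & null s'] ->
  general_position a r b s -> general_position a' r' b' s' ->
  cross b a r s = cross b' a' r' s' -> cross b r a s = cross b' r' a' s' ->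
  cross a r b s = cross a' r' b' s' ->
  exists N ka kr kb ks, [/\ SU31 N, [/\ ka != 0, kr != 0, kb != 0 & ks != 0] &
    [/\ N *m a = ka *: a', N *m r = kr *: r', N *m b = kb *: b' & N *m s = ks *: s']].
Proof.
move=> [[_ aa] [_ rr] [_ bb] [_ ss]] [[_ aa'] [_ rr'] [_ bb'] [_ ss']].
move=> [nz B T] [nz' B' T'].
(* All products are oriented along the order [a], [r], [b], [s], to fit the upper triangular entries
   in [gram_rescaling]. *)
rewrite /cross -!(herm_conj _ s) -!(herm_conj _ s') -(herm_conj a r) -(herm_conj a' r').
rewrite -(herm_conj a b) -(herm_conj a' b') -(herm_conj r b) -(herm_conj r' b').
move=> X1 X2 X3.
have [k1 [k2 [k3 [k4 [[k10 k20 k30 k40] [E12 E13 E14 [E23 E24 E34]]]]]]] :=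
  gram_rescaling nz nz' X1 X2 X3 T T'.
pose k i := tnth [tuple k1; k2; k3; k4] i.
have k0 i : k i != 0 by case: i => [[|[|[|[|//]]]] ?]; rewrite /k (tnth_nth 0).
(* The lower triangle of the Gram matrix follows by conjugation; the diagonal vanishes as the
   vectors are null. *)
have sym (x y z w : V) (c d : C) : c * d^* * herm x y = herm z w ->
    d * c^* * herm y x = herm w z.
  by move=> e; rewrite -(herm_conj z w) -e !rmorphM /= conjCK herm_conj [d * _]mulrC.
have [| N [c [SN c0 Nc]]] := gram_isometry B B' k0.
  case=> [[|[|[|[|//]]]] i4] [[|[|[|[|//]]]] j4];
  rewrite /k /vec4 !(tnth_nth 0) /= ?aa ?rr ?bb ?ss ?aa' ?rr' ?bb' ?ss' ?mulr0 //;
  by [|exact: sym].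
exists N, (c 0), (c 1), (c 2), (c 3); split=> //.
by split; rewrite -?(Nc 0) -?(Nc 1) -?(Nc 2) -?(Nc 3) /vec4 !(tnth_nth 0).
Qed.

(** The second pair supplies only reference points here, so the same statement serves for either
    generator with one common [N]. *)
Lemma conjugacy_by_beta (m : marking R) N A A' B B' (j : 'I_2) ka kr kb ks :
  loxodromic A -> loxodromic A' -> \tr A = \tr A' -> sigma A = sigma A' ->
  SU31 N -> [/\ ka != 0, kr != 0, kb != 0 & ks != 0] ->
  [/\ N *m att m A = ka *: att m A', N *m rpl m A = kr *: rpl m A',
      N *m att m B = kb *: att m B' & N *m rpl m B = ks *: rpl m B'] ->
  herm (att m A) (att m B) != 0 -> herm (att m A) (rpl m B) != 0 ->
  basis4 (att m A') (rpl m A') (att m B') (rpl m B') ->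
  beta m j A B != 0 -> beta m j A B = beta m j A' B' ->
  N *m A *m invmx N = A'.
Proof.
move=> loxA loxA' trE sE [dN hN] k0 Nk ab as_ basis' b0 bE.
have [l1 [l2 [mu [nu [q [q' [F F' E E']]]]]]] := marked_frames m j loxA loxA' trE sE.
have polar D t : hyperbolic_frame (att m D) (rpl m D) (pvec m j D) t ->
    herm (pvec m j D) (att m D) = 0 /\ herm (pvec m j D) (rpl m D) = 0.
  move=> [_ _ _ [_ _ _ [ax _ rx _]]].
  by rewrite -(herm_conj (att m D)) -(herm_conj (rpl m D)) ax rx conjC0.
have [[pa pr] [pa' pr']] := (polar _ _ F, polar _ _ F').
(* A nonzero quotient has a nonzero denominator, as [x / 0 = 0]. *)
have denom D D' : beta m j D D' != 0 -> herm (pvec m j D) (att m D') != 0.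
  by apply: contraNneq => z; rewrite /beta /cross z mulr0 invr0 mulr0.
have [e Np] : exists e, N *m pvec m j A = e *: pvec m j A'.
  apply: (isometry_polar_vector hN k0 Nk basis' pa pr pa' pr') => //.
  by split=> //; apply: denom; rewrite -?bE.
have [ka0 kr0 _ _] := k0; have [Na Nr _ _] := Nk.
rewrite (conjugacy_of_frames hN ka0 kr0 F F' E E' Na Nr Np) mulmxK //.
by rewrite unitmxE dN unitr1.
Qed.

End HermitianForm.

Theorem theorem1p1 (R : realType) (m : marking R) (A B A' B' : 'M[R[i]]_4)
    (i j : 'I_2)
    (loxA : loxodromic A) (loxB : loxodromic B)
    (loxA' : loxodromic A') (loxB' : loxodromic B')
    (nsAB : nonsingular_subgroup m A B)
    (nsAB' : nonsingular_subgroup m A' B')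
    (alpha_def : alpha_defined m i A B) (alpha_neq0 : alpha m i A B != 0)
    (beta_def : beta_defined m j A B) (beta_neq0 : beta m j A B != 0)
    (trA : \tr A = \tr A') (trB : \tr B = \tr B')
    (sigmaA : sigma A = sigma A') (sigmaB : sigma B = sigma B')
    (eqX1 : X1 m A B = X1 m A' B')
    (eqX2 : X2 m A B = X2 m A' B')
    (eqX3 : X3 m A B = X3 m A' B')
    (eq_alpha : alpha m i A B = alpha m i A' B')
    (eq_beta : beta m j A B = beta m j A' B') :
  exists C : 'M[R[i]]_4,
    [/\ SU31 C, C *m A *m invmx C = A' & C *m B *m invmx C = B'].

Proof.
have [[_ nsp] [_ nsp']] := (nsAB, nsAB').
have nul D : loxodromic D -> null (att m D) /\ null (rpl m D).
  by move=> l; split; [case: (bd_fixed_att m l) | case: (bd_fixed_rpl m l)].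
have [nA nrA] := nul A loxA; have [nB nrB] := nul B loxB.
have [nA' nrA'] := nul A' loxA'; have [nB' nrB'] := nul B' loxB'.
have G := nonsingular_general_position loxA loxB nsp.
have G' := nonsingular_general_position loxA' loxB' nsp'.
have [N [ka [kr [kb [ks [SN k0 Nk]]]]]] : exists N ka kr kb ks, [/\ SU31 N,
    [/\ ka != 0, kr != 0, kb != 0 & ks != 0] &
    [/\ N *m att m A = ka *: att m A', N *m rpl m A = kr *: rpl m A',
        N *m att m B = kb *: att m B' & N *m rpl m B = ks *: rpl m B']].
  exact: general_position_isometry G G' eqX1 eqX2 eqX3.
have [[_ ab as_ [rb rs bs]] _ _] := G; have [_ basis' _] := G'.
exists N; split=> //.
  exact: conjugacy_by_beta k0 Nk ab as_ basis' beta_neq0 eq_beta.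
have [[ka0 kr0 kb0 ks0] [Na Nr Nb Ns]] := (k0, Nk).
(* With the generators exchanged, [alpha m i A B] is literally [beta m i B A]. *)
apply: (@conjugacy_by_beta _ m N B B' A A' i kb ks ka kr) => //.
- by rewrite herm_eq0_sym.
- by rewrite herm_eq0_sym.
- exact: basis4_swap.
Qed.
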